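(* Let $n\ge 1$ and $N\ge 1$ be integers, and let $\delta,\varphi\in(0,\pi]$ satisfy $n\delta\leq\varphi$. Suppose that the complex numbers $z_1,\dots,z_N\in\mathbb U$ have the following two properties: (i) any open arc of $\mathbb U$ of length $\varphi$ contains at most $n$ of them; (ii) any open arc of $\mathbb U$ of length $\delta$ contains at most one of them. Write $N=\kappa n+r$ with $\kappa\ge 0$ an integer and $1\leq r\leq n$, and assume that $(\kappa+1)\varphi\leq2\pi$. Then \[ |z_1+\cdots+z_N| \leq\frac{\sin(r\delta/2)}{\sin(\delta/2)}\cdot \frac{\sin((\kappa+1)\varphi/2)}{\sin(\varphi/2)} +\frac{\sin((n-r)\delta/2)}{\sin(\delta/2)}\cdot \frac{\sin(\kappa\varphi/2)}{\sin(\varphi/2)}. \]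
   Context: $\mathbb U=\{z\in\mathbb C:|z|=1\}$ is the unit circle. For $u,v\in\mathbb U$ the arc $(u,v)$ consists of the points passed when moving counter-clockwise from $u$ to $v$; its length is the angle swept. ''Contains $m$ of them'' counts indices $j$ with $z_j$ in the arc (the $z_j$ are not assumed a priori distinct). *)

(* Defs.v *)
From mathcomp Require Export all_boot all_order all_algebra.
From mathcomp Require Export classical_sets boolp reals trigo.
From mathcomp Require Export complex.

Set Implicit Arguments.
Unset Strict Implicit.
Unset Printing Implicit Defensive.

Import Order.TTheory GRing.Theory Num.Theory.

Local Open Scope ring_scope.
Local Open Scope complex_scope.

Definition unit_circle (R : realType) : set R[i] :=
  [set z : R[i] | `|z| = 1]%classic.

Definition expi (R : realType) (t : R) : R[i] := cos t +i* sin t.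

(* The counter-clockwise move from u to v sweeps the angle l, i.e. the arc
   (u, v) has length l.  For u = v the swept angle is read as 0 (empty arc). *)
Definition arc_length (R : realType) (u v : R[i]) (l : R) : Prop :=
  (0 <= l < 2 * pi) /\ v = u * expi l.

Definition open_arc (R : realType) (u v : R[i]) : set R[i] :=
  [set w : R[i] | exists l t : R,
     [/\ arc_length u v l, 0 < t < l & w = u * expi t]]%classic.

(* Indices are counted, so repeated points count with multiplicity. *)
Definition arc_count (R : realType) (N : nat) (z : 'I_N -> R[i])
    (u v : R[i]) : nat :=
  #|[pred j : 'I_N | z j \in open_arc u v]|.

Definition arcs_contain_at_most (R : realType) (N : nat) (z : 'I_N -> R[i])
    (l : R) (m : nat) : Prop :=
  forall u v : R[i], unit_circle u -> unit_circle v ->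
    arc_length u v l -> (arc_count z u v <= m)%N.

(* Main.v *)
(* After a rotation, |S| is the sum of cos t_j over sorted angles t_j in
   [-pi, pi], and the arc conditions read t_j + phi <= t_(j+n) and
   t_j + delta <= t_(j+1).  Split the indices into residue classes mod n: r of
   them have kappa + 1 points, the other n - r have kappa points.  In a class of
   k points, put p = (last point) - (k - 1) phi / 2 and
   q = (first point) + (k - 1) phi / 2.  Since the points are phi-separated,
   the cosine sum of the class is at most
     sin (k phi / 2) / sin (phi / 2) * cos v,
   where v is p cut off at phi / 2, or likewise q cut off at - phi / 2.  Taking
   v = p if p >= 0 and v = q otherwise makes the v's of successive classes
   delta-separated before the cut-off, so the same bound, applied to them with
   delta in place of phi, finishes the proof. *)
Require Import Defs.
From mathcomp Require Import ring lra zify.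

Set Implicit Arguments.
Unset Strict Implicit.
Unset Printing Implicit Defensive.

Import Order.TTheory GRing.Theory Num.Theory.
Local Open Scope ring_scope.
Local Open Scope complex_scope.

(** * Trigonometric kernel and cut-off *)

(** When [sin (x / 2)] is nonzero, this is the sum of the cosines of [k] angles in arithmetic
    progression of step [x] centred at 0. *)
Definition dirichlet (R : realType) (k : nat) (x : R) : R :=
  sin (k%:R * x / 2) / sin (x / 2).

Definition clamp (R : realType) (X x : R) : R := Num.max (- X) (Num.min x X).

Lemma le_cos_norm (R : realType) (x y : R) :
  `|y| <= pi -> `|x| <= `|y| -> cos y <= cos x.
Proof.
move=> y_pi xy; rewrite -(cos_norm x) -(cos_norm y).
by rewrite leNgt ltr_cos -?leNgt ?in_itv /= ?normr_ge0 ?(le_trans xy).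
Qed.

Lemma sin_half_gt0 (R : realType) (x : R) : 0 < x <= pi -> 0 < sin (x / 2).
Proof. by move=> x_pi; apply: sin_gt0_pi; lra. Qed.

Lemma dirichlet0 (R : realType) (x : R) : dirichlet 0 x = 0.
Proof. by rewrite /dirichlet !mul0r sin0 mul0r. Qed.

Lemma dirichlet_ge0 (R : realType) (k : nat) (x : R) :
  0 < x <= pi -> k%:R * x <= 2 * pi -> 0 <= dirichlet k x.
Proof.
move=> x_pi kx; rewrite divr_ge0 //; last exact/ltW/sin_half_gt0.
have : 0 <= k%:R * x by rewrite mulr_ge0 //; lra.
by move=> kx0; apply: sin_ge0_pi; lra.
Qed.

(** Splits the last angle off a progression centred at [p]: the remaining [k] angles are centred at
    [p - x / 2]. *)
Lemma dirichletS_cos (R : realType) (k : nat) (x p : R) : 0 < x <= pi ->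
  dirichlet k.+1 x * cos p =
  dirichlet k x * cos (p - x / 2) + cos (p + k%:R * x / 2).
Proof.
move=> /sin_half_gt0 s_gt0.
have -> : dirichlet k.+1 x = sin (k%:R * x / 2 + x / 2) / sin (x / 2).
  by rewrite /dirichlet -natr1; congr (sin _ / _); ring.
rewrite /dirichlet sinD cosB cosD; field.
by rewrite gt_eqF.
Qed.

(** Lets a point cut off at [X] be removed in an induction. Centring the progression at [x / 2]
    makes its last angle [k.+1%:R * x / 2], which is at most [X]. *)
Lemma dirichletS_ge (R : realType) (k : nat) (x X : R) : 0 < x <= pi ->
  k.+1%:R * x <= 2 * X -> 2 * X <= pi ->
  dirichlet k x + cos X <= dirichlet k.+1 x.
Proof.
move=> x_pi kxX X_pi; have pi0 := pi_gt0 R.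
have kx0 : 0 <= k%:R * x by rewrite mulr_ge0 //; lra.
have E := dirichletS_cos k (x / 2) x_pi.
rewrite subrr cos0 mulr1 in E.
have kx1 : k.+1%:R * x = k%:R * x + x by rewrite -natr1; ring.
have D0 : 0 <= dirichlet k.+1 x by apply: dirichlet_ge0 => //; lra.
apply: (@le_trans _ _ (dirichlet k.+1 x * cos (x / 2))).
  by rewrite E lerD2l; apply: le_cos_norm; rewrite !ger0_norm; lra.
by rewrite ler_piMr // cos_le1.
Qed.

(** * Cosine sums of separated angles *)

Lemma gapped_le (R : realDomainType) (k : nat) (u : nat -> R) (d : R) :
  (forall s, (s < k)%N -> u s + d <= u s.+1) ->
  forall i j, (i <= j)%N -> (j <= k)%N -> u i + (j - i)%:R * d <= u j.
Proof.
move=> gap i j; elim: j => [|j IH].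
  by rewrite leqn0 => /eqP ->; rewrite subnn mul0r addr0.
rewrite leq_eqVlt => /orP[/eqP -> _|]; first by rewrite subnn mul0r addr0.
rewrite ltnS => ij jk; rewrite subSn // -natr1.
have := IH ij (ltnW jk); have := gap j jk; lra.
Qed.

(* The cut-off is needed: once the last point passes [k.+1%:R * phi / 2], the
   other points are best left in a progression centred at [0]. *)
Lemma chain_cos_le_last (R : realType) (phi : R) (k : nat) (u : nat -> R) :
  0 < phi <= pi -> k.+1%:R * phi <= 2 * pi ->
  (forall s, (s <= k)%N -> - pi <= u s <= pi) ->
  (forall s, (s < k)%N -> u s + phi <= u s.+1) ->
  \sum_(s < k.+1) cos (u s) <=
    dirichlet k.+1 phi * cos (Num.min (u k - k%:R * phi / 2) (phi / 2)).
Proof.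
move=> phi_pi; elim: k => [|k IH] kphi u_pi gap.
  have := u_pi 0%N isT.
  rewrite big_ord1 /dirichlet mul1r divff ?mul1r ?mul0r ?subr0; last first.
    by rewrite gt_eqF ?sin_half_gt0.
  case: (leP (u 0%N) (phi / 2)) => // h u0.
  by apply: le_cos_norm; rewrite !ger0_norm; lra.
have kphi1 : k.+2%:R * phi = k.+1%:R * phi + phi by rewrite -natr1; ring.
have kphi2 : k.+1%:R * phi = k%:R * phi + phi by rewrite -natr1; ring.
have kphi0 : 0 <= k%:R * phi by rewrite mulr_ge0 //; lra.
rewrite big_ord_recr /=.
have u0k := gapped_le gap (leq0n k) (leqnSn k); rewrite subn0 in u0k.
have u0 := u_pi 0%N isT.
have {}IH := IH _ (fun s sk => u_pi s (leqW sk)) (fun s sk => gap s (leqW sk)).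
have {IH} := IH ltac:(lra).
set p := u k - _; set p' := u k.+1 - _ => IH.
have D0 : 0 <= dirichlet k.+1 phi by apply: dirichlet_ge0 => //; lra.
have pp' : p <= p' - phi / 2.
  by rewrite /p /p'; have := gap k (leqnn _); lra.
have uk := u_pi k (leqnSn _); have uk1 := u_pi k.+1 (leqnn _).
case: (leP p' (phi / 2)) => hp'.
  (* No cut-off: [p <= p' - phi / 2 <= 0], and [p >= - pi] because [u k] is at least
     [k%:R * phi - pi]. *)
  rewrite dirichletS_cos //.
  have -> : p' + k.+1%:R * phi / 2 = u k.+1 by rewrite /p'; lra.
  rewrite lerD2r; apply: (le_trans IH); rewrite ler_wpM2l //.
  rewrite min_l; last lra.
  have pE : p = u k - k%:R * phi / 2 by [].
  by apply: le_cos_norm; rewrite !ler0_norm; lra.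
(* Cut-off: the progression is centred at [phi / 2], and [u k.+1] lies beyond its last angle. *)
rewrite dirichletS_cos // subrr cos0 mulr1.
apply: lerD; first by apply: (le_trans IH); rewrite ler_piMr // cos_le1.
by apply: le_cos_norm; rewrite !ger0_norm; rewrite /p' in hp'; lra.
Qed.

(** Mirror image of [chain_cos_le_last]: negate the angles and reverse their order. *)
Lemma chain_cos_le_first (R : realType) (phi : R) (k : nat) (u : nat -> R) :
  0 < phi <= pi -> k.+1%:R * phi <= 2 * pi ->
  (forall s, (s <= k)%N -> - pi <= u s <= pi) ->
  (forall s, (s < k)%N -> u s + phi <= u s.+1) ->
  \sum_(s < k.+1) cos (u s) <=
    dirichlet k.+1 phi * cos (Num.max (- (phi / 2)) (u 0%N + k%:R * phi / 2)).
Proof.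
move=> phi_pi kphi u_pi gap.
have := @chain_cos_le_last R phi k (fun s => - u (k - s)%N) phi_pi kphi.
rewrite subnn -opprD -(cosN (Num.max _ _)) oppr_max opprK minC.
rewrite (reindex_inj rev_ord_inj) /=; under eq_bigr => s _.
  rewrite cosN subSS subKn; last by rewrite -ltnS.
  over.
apply=> [s sk|s sk]; first by have := u_pi (k - s)%N (leq_subr _ _); lra.
have := gap (k - s.+1)%N; rewrite subnSK // => /(_ (leq_subr _ _)); lra.
Qed.

(** An extreme point beyond the cut-off contributes exactly [cos X], and [dirichletS_ge] absorbs it.
    If neither extreme point is beyond, no point is, and the chain bound applies. *)
Lemma clamped_cos_le (R : realType) (delta X : R) (m : nat) (v : nat -> R) :
  0 < delta <= pi -> 0 <= 2 * X <= pi -> m%:R * delta <= 2 * X ->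
  (forall i, (i.+1 < m)%N -> v i + delta <= v i.+1) ->
  \sum_(i < m) cos (clamp X (v i)) <= dirichlet m delta.
Proof.
move=> d_pi X_pi; elim: m v => [|m IH] v mX gap.
  by rewrite big_ord0 dirichlet0.
have mX' : m%:R * delta <= 2 * X by move: mX; rewrite -natr1; lra.
have DS := dirichletS_ge d_pi mX (proj2 (andP X_pi)).
case: (ltP X (v m)) => [Xv|vX].
  rewrite big_ord_recr /=; apply: le_trans DS; apply: lerD.
    by apply: IH => // i im; apply: gap; apply: leqW.
  by rewrite /clamp min_r ?max_r //; lra.
case: (ltP (v 0%N) (- X)) => [vX0|Xv0].
  rewrite big_ord_recl /= addrC; apply: le_trans DS; apply: lerD.
    by apply: (IH (fun i => v i.+1)) => // i im; apply: gap.
  by rewrite /clamp min_l ?max_l ?cosN //; lra.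
have inX i : (i <= m)%N -> - X <= v i <= X.
  move=> im; have G := gapped_le gap.
  have := G 0%N i isT im; have := G i m im (leqnn _).
  have : 0 <= (m - i)%:R * delta by rewrite mulr_ge0 //; lra.
  have : 0 <= (i - 0)%:R * delta by rewrite mulr_ge0 //; lra.
  lra.
rewrite (eq_bigr (fun i : 'I_m.+1 => cos (v i))); last first.
  move=> i _; have vi := inX i (ltn_ord i).
  by rewrite /clamp min_l ?max_r //; lra.
apply: (le_trans (chain_cos_le_last d_pi _ _ gap)); [lra | |].
  by move=> i im; have := inX i im; lra.
by rewrite ler_piMr ?cos_le1 // dirichlet_ge0 //; lra.
Qed.

Lemma grid_cos_le (R : realType) (delta phi : R) (m k : nat)
    (u : nat -> nat -> R) :
  0 < delta <= pi -> 0 < phi <= pi ->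
  m%:R * delta <= phi -> k%:R * phi <= 2 * pi ->
  (forall i s, (i < m)%N -> (s < k)%N -> - pi <= u i s <= pi) ->
  (forall i s, (i < m)%N -> (s.+1 < k)%N -> u i s + phi <= u i s.+1) ->
  (forall i s, (i.+1 < m)%N -> (s < k)%N -> u i s + delta <= u i.+1 s) ->
  \sum_(i < m) \sum_(s < k) cos (u i s) <= dirichlet m delta * dirichlet k phi.
Proof.
move=> d_pi phi_pi md; case: k => [|k] kphi u_pi gap_phi gap_delta.
  by rewrite dirichlet0 mulr0 big1 // => i _; rewrite big_ord0.
pose p i := u i k - k%:R * phi / 2; pose q i := u i 0%N + k%:R * phi / 2.
have qp i : (i < m)%N -> q i <= p i.
  move=> im.
  have := gapped_le (fun s => gap_phi i s im) (leq0n k) (leqnn k).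
  by rewrite subn0 /p /q; lra.
pose v i := if 0 <= p i then p i else q i.
have D0 := dirichlet_ge0 phi_pi kphi.
apply: (@le_trans _ _
    (\sum_(i < m) dirichlet k.+1 phi * cos (clamp (phi / 2) (v i)))).
  apply: ler_sum => i _; have im := ltn_ord i; rewrite /v /clamp.
  have u_i s := u_pi i s im; have gap_i s := gap_phi i s im.
  case: (leP 0 (p i)) => pi0.
    (* Only one side of the clamp can act: the upper one if [p i >= 0], the lower one if
       [q i <= p i < 0]. *)
    rewrite max_r; last by rewrite le_min; lra.
    exact: (chain_cos_le_last phi_pi kphi u_i gap_i).
  rewrite (min_l (x := q i)); last by have := qp i im; lra.
  exact: (chain_cos_le_first phi_pi kphi u_i gap_i).
rewrite -mulr_sumr mulrC ler_wpM2r //.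
apply: clamped_cos_le => //; [lra|lra|] => i im; rewrite /v.
(* Both [p] and [q] grow by at least [delta]. A switch from [q] to [p] only widens the gap, as
   [q i <= p i]; a switch back is impossible, since [p] increases. *)
have := gap_delta i k im (leqnn _); have := gap_delta i 0%N im isT.
have := qp i (ltnW im); rewrite /p /q.
by do 2 case: (leP 0 _) => ?; lra.
Qed.

(** * Angles of unit complex numbers *)

Lemma expiD (R : realType) (a b : R) : expi (a + b) = expi a * expi b.
Proof. by rewrite /expi cosD sinD; simpc; rewrite [sin a * _ + _]addrC. Qed.

Lemma normc_expi (R : realType) (a : R) : `|expi a| = 1.
Proof. by rewrite normc_def /= cos2Dsin2 sqrtr1. Qed.

Lemma unit_circle_expi (R : realType) (z : R[i]) :
  unit_circle z -> exists2 t : R, - pi <= t <= pi & z = expi t.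
Proof.
case: z => a b; rewrite /unit_circle /= normc_def /= => -[/eqP].
rewrite -sqrtr1 eqr_sqrt ?ler01 ?addr_ge0 ?sqr_ge0 // => /eqP ab1.
have b2 : b ^+ 2 = 1 - a ^+ 2 by lra.
have a1 : -1 <= a <= 1.
  rewrite -ler_norml -(ler_sqr (x := `|a|)) ?nnegrE // real_normK ?num_real //.
  by rewrite expr1n; have := sqr_ge0 b; lra.
have [ge0 lepi] := (acos_ge0 a1, acos_lepi a1).
case: (leP 0 b) => b0.
  exists (acos a); first lra.
  by rewrite /expi acosK ?in_itv // sin_acos // -b2 sqrtr_sqr ger0_norm.
exists (- acos a); first lra.
rewrite /expi cosN sinN acosK ?in_itv // sin_acos // -b2 sqrtr_sqr.
by rewrite ltr0_norm // opprK.
Qed.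

Lemma polar (R : realType) (z : R[i]) :
  exists2 w, unit_circle w & z = `|z| * w.
Proof.
have [->|z0] := eqVneq z 0.
  by exists 1; rewrite /unit_circle /= ?normr0 ?mul0r ?normr1.
exists (z / `|z|); last by rewrite mulrC mulfVK ?normr_eq0.
by rewrite /unit_circle /= normf_div normr_id divff ?normr_eq0.
Qed.

(** If [m + 1] consecutive sorted angles spanned less than [l], one open arc of length [l] would
    contain all their points. *)
Lemma sorted_gap (R : realType) (N : nat) (z : 'I_N -> R[i]) (w : R[i])
    (theta : 'I_N -> R) (s : seq 'I_N) (i0 : 'I_N) (l : R) (m : nat) :
  unit_circle w -> (forall j, z j = w * expi (theta j)) ->
  uniq s -> sorted (relpre theta <=%R) s ->
  0 < l <= pi -> arcs_contain_at_most z l m ->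
  forall j, (j + m < size s)%N ->
    theta (nth i0 s j) + l <= theta (nth i0 s (j + m)).
Proof.
move=> w1 zE s_uniq s_sorted l_pi arcs j jm; rewrite leNgt; apply/negP => lt_l.
have pi0 := pi_gt0 R.
set a := theta (nth i0 s j) in lt_l; set b := theta _ in lt_l.
(* The open arc from [a - e] to [a - e + l] contains the closed one from [a] to
   [b]. *)
pose e := (a + l - b) / 2.
have mono p q : (p <= q < size s)%N -> theta (nth i0 s p) <= theta (nth i0 s q).
  case/andP=> pq qs.
  apply: (sorted_leq_nth (leT := relpre theta <=%R)) => //.
  - by move=> x y t /= xy; apply: le_trans.
  - by move=> x /=.
  - by rewrite inE (leq_ltn_trans pq).
have circ t : unit_circle (w * expi t).
  by move: w1; rewrite /unit_circle /= normrM normc_expi mulr1.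
have lenl : arc_length (w * expi (a - e)) (w * expi (a - e + l)) l.
  by split; [lra | rewrite -mulrA -expiD].
have := arcs _ _ (circ _) (circ _) lenl; rewrite leqNgt => /negP; apply.
have sz : size (take m.+1 (drop j s)) = m.+1.
  by rewrite size_takel // size_drop ltn_subRL.
rewrite -sz -(card_uniqP _) ?take_uniq ?drop_uniq //.
apply: subset_leq_card; apply/fintype.subsetP => x /(nthP i0) [p].
rewrite sz => pm <-.
rewrite nth_take // nth_drop inE.
exists l, (theta (nth i0 s (j + p)) - (a - e)); split=> //.
  have := mono j (j + p)%N; have := mono (j + p)%N (j + m)%N.
  rewrite leq_addr leq_add2l -ltnS pm jm /= -/a -/b => /(_ isT) pb.
  have -> : (j + p < size s)%N.
    by apply: leq_ltn_trans jm; rewrite leq_add2l -ltnS.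
  by move=> /(_ isT) ap; rewrite /e; lra.
by rewrite zE -mulrA -expiD; congr (_ * expi _); lra.
Qed.

(** Induction on [kappa]: the first block of [n] indices supplies the term [s = 0] of every residue
    class. *)
Lemma sum_residues (V : zmodType) (n kappa r : nat) (F : nat -> V) :
  (r <= n)%N ->
  \sum_(0 <= j < kappa * n + r) F j =
  \sum_(i < r) \sum_(s < kappa.+1) F (s * n + i)%N +
  \sum_(i < n - r) \sum_(s < kappa) F (s * n + (r + i))%N.
Proof.
move=> r_n; elim: kappa F => [|kappa IH] F.
  rewrite mul0n add0n big_mkord [X in _ + X]big1 ?addr0; last first.
    by move=> i _; rewrite big_ord0.
  by apply: eq_bigr => i _; rewrite big_ord1.
have shift a b (G : nat -> V) :
    \sum_(a <= j < a + b) G j = \sum_(0 <= j < b) G (a + j)%N.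
  by rewrite -{1}[a]add0n big_addn addKn; apply: eq_bigr => j _; rewrite addnC.
rewrite mulSn -addnA (big_cat_nat (n := n)) ?leq_addr //= (shift n).
have /= -> := IH (fun j => F (n + j)%N); rewrite (big_cat_nat (n := r)) //=.
rewrite -{1}(subnKC r_n) (shift r) !big_mkord.
under [X in _ = X + _]eq_bigr do rewrite big_ord_recl mul0n add0n.
under [X in _ = _ + X]eq_bigr do rewrite big_ord_recl mul0n add0n.
rewrite !big_split /= addrACA; congr (_ + _ + (_ + _)).
- by apply: eq_bigr => i _; apply: eq_bigr => s _; rewrite mulSn addnA.
- by apply: eq_bigr => i _; apply: eq_bigr => s _; rewrite mulSn addnA.
Qed.

Theorem theorem3 (R : realType) (n N kappa r : nat) (delta phi : R)
    (z : 'I_N -> R[i])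
    (n_ge1 : (1 <= n)%N) (N_ge1 : (1 <= N)%N)
    (delta_bounds : 0 < delta <= pi) (phi_bounds : 0 < phi <= pi)
    (n_delta_le_phi : n%:R * delta <= phi)
    (z_unit : forall j : 'I_N, unit_circle (z j))
    (phi_arcs : arcs_contain_at_most z phi n)
    (delta_arcs : arcs_contain_at_most z delta 1)
    (N_eq : N = (kappa * n + r)%N) (r_bounds : (1 <= r <= n)%N)
    (kappa_phi : (kappa%:R + 1) * phi <= 2 * pi) :
  `|\sum_(j < N) z j| <=
    (sin (r%:R * delta / 2) / sin (delta / 2) *
       (sin ((kappa%:R + 1) * phi / 2) / sin (phi / 2)) +
     sin ((n%:R - r%:R) * delta / 2) / sin (delta / 2) *
       (sin (kappa%:R * phi / 2) / sin (phi / 2)))%:C.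
Proof.
case/andP: r_bounds => r_ge1 r_len.
(* Angles are measured from the direction [w] of the sum, so that the rotated sum is real and only
   cosines remain. *)
have [w w1 SE] := polar (\sum_(j < N) z j).
have w0 : w != 0 by rewrite -normr_eq0 w1 oner_eq0.
have /choice [theta thetaP] :
    forall j, exists t, - pi <= t <= pi /\ z j = w * expi t.
  move=> j.
  have [|t t_pi tE] := @unit_circle_expi R (z j / w).
    by have := z_unit j; rewrite /unit_circle /= normf_div w1 divr1.
  by exists t; rewrite -tE mulrC divfK.
have normE : `|\sum_(j < N) z j| = (\sum_(j < N) cos (theta j))%:C.
  have E : \sum_(j < N) expi (theta j) = `|\sum_(j < N) z j|.
    apply: (mulfI w0); rewrite [RHS]mulrC -SE mulr_sumr.
    by apply: eq_bigr => j _; rewrite (thetaP j).2.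
  have -> : `|\sum_(j < N) z j| = (complex.Re `|\sum_(j < N) z j|)%:C.
    by rewrite normc_def.
  rewrite -E; congr (_%:C).
  have ReD : {morph @complex.Re R : x y / x + y} by case=> a b [c d].
  by rewrite (big_morph (@complex.Re R) ReD (erefl : complex.Re 0 = 0)).
rewrite normE lecR.
pose i0 := Ordinal N_ge1.
pose s := sort (relpre theta <=%R) (enum 'I_N).
have sizes : size s = N by rewrite size_sort size_enum_ord.
pose t j := theta (nth i0 s j).
have s_uniq : uniq s by rewrite sort_uniq enum_uniq.
have s_sorted : sorted (relpre theta <=%R) s.
  by apply: sort_sorted => x y /=; apply: le_total.
have gap l m : 0 < l <= pi -> arcs_contain_at_most z l m ->
    forall j, (j + m < N)%N -> t j + l <= t (j + m)%N.
  move=> l_pi arcs j jm.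
  apply: (sorted_gap i0 w1 _ s_uniq s_sorted l_pi arcs); last by rewrite sizes.
  by move=> k; rewrite (thetaP k).2.
have -> : \sum_(j < N) cos (theta j) = \sum_(0 <= j < N) cos (t j).
  rewrite -[X in \sum_(0 <= _ < X) _]sizes.
  rewrite -(big_nth i0 xpredT (fun i => cos (theta i))).
  by rewrite [RHS](perm_big (enum 'I_N)) ?perm_sort //= big_enum.
have t_pi j : - pi <= t j <= pi by apply: (thetaP _).1.
rewrite {1}N_eq sum_residues //.
have natrS : kappa.+1%:R = kappa%:R + 1 :> R by rewrite natr1.
have step_phi := gap _ _ phi_bounds phi_arcs.
have step_delta := gap _ _ delta_bounds delta_arcs.
have nr_delta : n%:R * delta = r%:R * delta + (n - r)%:R * delta.
  by rewrite -mulrDl -natrD subnKC.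
have d0 k : 0 <= k%:R * delta by rewrite mulr_ge0 //; lra.
have mul_le k k' : (k <= k')%N -> (k * n <= k' * n)%N.
  by move=> kk; rewrite leq_mul.
(* Within a class the index advances by [n], giving gaps [phi]; between neighbouring classes it
   advances by 1, giving gaps [delta]. *)
rewrite -natrB // -natrS; apply: lerD.
  apply: (grid_cos_le (u := fun i k => t (k * n + i)%N)) => //.
  - by have := d0 (n - r)%N; lra.
  - by rewrite natrS.
  - move=> i k ir; rewrite !ltnS mulSnr addnAC => /mul_le kn.
    by apply: step_phi; lia.
  - move=> i k ir; rewrite !ltnS -addn1 addnA => /mul_le kn.
    by apply: step_delta; lia.
apply: (grid_cos_le (u := fun i k => t (k * n + (r + i))%N)) => //.
- by have := d0 r; lra.
- by move: kappa_phi; lra.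
- move=> i k inr /mul_le; rewrite !mulSnr addnAC => kn.
  by apply: step_phi; lia.
- move=> i k inr /mul_le; rewrite mulSnr -addn1 !addnA => kn.
  by apply: step_delta; lia.
Qed.
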